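(* Let $\mathcal{M}=(n,Q,\Sigma,\Gamma,\Delta,q_0,\gamma_0,F)$ be an OMPA (in normal form) with $n>1$. Then it is possible to construct a GPA $\mathcal{P}=(P,\Sigma',\Gamma,\delta,p_0,\bot,\{p_f\})$ with $P=Q\cup\{p_0,p_f\}$ (where $p_0,p_f\notin Q$) and $\Sigma'=\emptyset$ such that: (1) $L(\mathcal{M})\neq\emptyset$ if and only if $L(\mathcal{P})\neq\emptyset$; and (2) for every $p_1,p_2\in P$ and $\gamma\in\Gamma$ there is an $(n-1)$-OMPA $\mathcal{M}_{(p_1,\gamma,p_2)}$ with input alphabet $\Gamma$ such that $L(\mathcal{M}_{(p_1,\gamma,p_2)}) = (\delta(p_1,\gamma,\epsilon,p_2))^R$ and $|\mathcal{M}_{(p_1,\gamma,p_2)}| = O(|\mathcal{M}|^2)$.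
   Context: For a finite alphabet $X$, $X_\epsilon=X\cup\{\epsilon\}$; for a language $L$, $L^R=\{u^R : u\in L\}$ where $u^R$ is the mirror (reversal) of $u$. A multi-pushdown automaton (MPA) is $\mathcal{M}=(n,Q,\Sigma,\Gamma,\Delta,q_0,\gamma_0,F)$ with $n\ge1$ stacks, finite nonempty state set $Q$, finite input alphabet $\Sigma$, finite stack alphabet $\Gamma\ni\bot$, $q_0\in Q$, $\gamma_0\in\Gamma\setminus\{\bot\}$, $F\subseteq Q$, and $\Delta\subseteq(Q\times(\Gamma_\epsilon)^n)\times\Sigma_\epsilon\times(Q\times(\Gamma^* )^n)$ such that for each transition $((q,\gamma_1,\dots,\gamma_n),a,(q',\alpha_1,\dots,\alpha_n))$ and each $i$: $|\alpha_i|\le2$; if $\gamma_i\ne\bot$ then $\alpha_i\in(\Gamma\setminus\{\bot\})^*$; if $\gamma_i=\bot$ then $\alpha_i=\alpha_i'\bot$ with $\alpha_i'\in(\Gamma\setminus\{\bot\})\cup\{\epsilon\}$. $|\mathcal{M}|=n+|Q|+|\Sigma|+|\Gamma|+|\Delta|$. $\mathit{Stack}(\mathcal{M})=(\Gamma\setminus\{\bot\})^*\bot$; configurations are $(q,w_1,\dots,w_n)$ with $w_i\in\mathit{Stack}(\mathcal{M})$; each transition gives steps $(q,\gamma_1w_1,\dots,\gamma_nw_n)\xrightarrow{a}(q',\alpha_1w_1,\dots,\alpha_nw_n)$ whenever $\gamma_iw_i\in\mathit{Stack}(\mathcal{M})$. $L(\mathcal{M})$ is the set of $\tau\in\Sigma^*$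 labelling a finite sequence of steps from $(q_0,\gamma_0\bot,\bot,\dots,\bot)$ to a configuration with state in $F$ and all stacks equal to $\bot$. An OMPA is an MPA where each transition has, for some $i$, $\gamma_1=\dots=\gamma_{i-1}=\bot$, $\gamma_i\in\Gamma_\epsilon$, $\gamma_{i+1}=\dots=\gamma_n=\epsilon$; an $n$-OMPA has $n$ stacks. Normal form: every transition is either (a) $((q,\gamma,\epsilon,\dots,\epsilon),a,(q',\alpha_1,\dots,\alpha_n))$ with $\gamma\in\Gamma$, $\alpha_1\in\Gamma^*$, $\alpha_j\in(\Gamma\setminus\{\bot\})\cup\{\epsilon\}$ for $j\ge2$, or (b) a transition popping $\gamma\in\Gamma\setminus\{\bot\}$ from stack $i\in[2,n]$ (stacks $1..i-1$ read $\bot$, the rest $\epsilon$) and producing $\gamma'\bot$ on stack 1 ($\gamma'\in\Gamma\setminus\{\bot\}$), $\bot$ on stacks $2..i-1$, $\epsilon$ on stacks $i..n$. The paper assumes throughout that all OMPAs are in normal form. A generalized pushdown automaton (GPA) is $\mathcal{P}=(P,\Sigma',\Gamma,\delta,p_0,\gamma_0,F)$ with finite state set $P$, input alphabet $\Sigma'$, stack alphabet $\Gamma$, $\delta:P\times\Gamma\times\Sigma'_\epsilon\times P\to 2^{\Gamma^*}$, initial state $p_0$, initial stack symbol $\gamma_0$, final states $F$; configurations $(p,w)\in P\times\Gamma^*$; steps $(p,\gamma w)\xrightarrow{a}(p',uw)$ for $u\in\delta(p,\gamma,a,p')$; $L(\mathcal{P})$ is the set of words labelling finite step sequences from $(p_0,\gamma_0)$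 to some $(p,\epsilon)$ with $p\in F$. *)

(* Defs.v *)
From mathcomp Require Import all_boot.

Set Implicit Arguments.
Unset Strict Implicit.
Unset Printing Implicit Defensive.

(** * Words, languages, labelled runs *)

(* [option T] plays the role of $T_\epsilon$: [None] is the empty word. *)
Definition oword (T : Type) (x : option T) : seq T :=
  if x is Some a then [:: a] else [::].

Definition language (A : Type) := seq A -> Prop.

Definition lang_nonempty (A : Type) (L : language A) : Prop := exists w, L w.

Definition lang_eq (A : Type) (L1 L2 : language A) : Prop :=
  forall w, L1 w <-> L2 w.

Definition lang_rev (A : Type) (L : language A) : language A :=
  fun w => exists2 u, L u & w = rev u.

Inductive run (C A : Type) (step : C -> option A -> C -> Prop) :
    C -> seq A -> C -> Prop :=
| run_nil c : run step c [::] c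
| run_cons c a c' w c'' :
    step c a c' -> run step c' w c'' -> run step c (oword a ++ w) c''.

(** * Multi-pushdown automata *)

(* Stacks are numbered from 0: the paper's stack $i$ is the ordinal $i-1$.
   The bound $|\alpha_i| \le 2$ is carried by the type [2.-bseq G], so that
   transitions form a [finType]. *)
Definition transition (n : nat) (Q Sigma G : finType) : Type :=
  ((Q * {ffun 'I_n -> option G}) * option Sigma *
   (Q * {ffun 'I_n -> 2.-bseq G}))%type.

Section Transition.
Variables (n : nat) (Q Sigma G : finType) (t : transition n Q Sigma G).
Definition src : Q := t.1.1.1.
Definition pop (i : 'I_n) : option G := t.1.1.2 i.
Definition label : option Sigma := t.1.2.
Definition dst : Q := t.2.1.
Definition push (i : 'I_n) : seq G := t.2.2 i.
End Transition.

Definition transition_wf (n : nat) (Q Sigma G : finType) (bot : G)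
    (t : transition n Q Sigma G) : Prop :=
  forall i : 'I_n,
    (pop t i <> Some bot -> bot \notin push t i) /\
    (pop t i = Some bot ->
       exists2 g : option G, g <> Some bot & push t i = oword g ++ [:: bot]).

Record mpa (n : nat) (Q Sigma G : finType) := MPA {
  mpa_bot : G;
  mpa_trans : {set transition n Q Sigma G};
  mpa_init : Q;
  mpa_gamma0 : G;
  mpa_final : {set Q};
  mpa_stacks_gt0 : 0 < n;
  mpa_gamma0_neq_bot : mpa_gamma0 <> mpa_bot;
  mpa_trans_wf : forall t, t \in mpa_trans -> transition_wf mpa_bot t
}.

Section MPA.
Variables (n : nat) (Q Sigma G : finType) (M : mpa n Q Sigma G).

Definition mpa_size : nat := n + #|Q| + #|Sigma| + #|G| + #|mpa_trans M|.

Definition is_stack (w : seq G) : Prop :=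
  exists2 u, mpa_bot M \notin u & w = u ++ [:: mpa_bot M].

Definition mpa_config : Type := (Q * {ffun 'I_n -> seq G})%type.

Definition mpa_step (c : mpa_config) (a : option Sigma) (c' : mpa_config) :
    Prop :=
  exists (t : transition n Q Sigma G) (w : {ffun 'I_n -> seq G}),
    [/\ t \in mpa_trans M,
        forall i, is_stack (oword (pop t i) ++ w i),
        c = (src t, [ffun i => oword (pop t i) ++ w i]),
        a = label t
      & c' = (dst t, [ffun i => push t i ++ w i])].

Definition mpa_init_config : mpa_config :=
  (mpa_init M,
   [ffun i : 'I_n => if i == 0 :> nat then [:: mpa_gamma0 M; mpa_bot M]
                     else [:: mpa_bot M]]).

Definition mpa_empty_config (q : Q) : mpa_config :=
  (q, [ffun=> [:: mpa_bot M]]).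

Definition mpa_lang : language Sigma := fun tau =>
  exists2 q, q \in mpa_final M &
    run mpa_step mpa_init_config tau (mpa_empty_config q).

Definition ordered : Prop :=
  forall t, t \in mpa_trans M ->
    exists i : 'I_n,
      (forall j : 'I_n, j < i -> pop t j = Some (mpa_bot M)) /\
      (forall j : 'I_n, i < j -> pop t j = None).

Definition normal_pop_first (t : transition n Q Sigma G) : Prop :=
  exists g : G, forall j : 'I_n,
    pop t j = (if j == 0 :> nat then Some g else None) /\
    (0 < j ->
       exists2 h : option G, h <> Some (mpa_bot M) & push t j = oword h).

Definition normal_pop_higher (t : transition n Q Sigma G) : Prop :=
  exists (i : 'I_n) (g g' : G),
    [/\ 0 < i, g <> mpa_bot M, g' <> mpa_bot M &
      forall j : 'I_n,
        pop t j = (if j < i then Some (mpa_bot M)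
                   else if j == i then Some g else None) /\
        push t j = (if j == 0 :> nat then [:: g'; mpa_bot M]
                    else if j < i then [:: mpa_bot M] else [::])].

Definition normal_form : Prop :=
  forall t, t \in mpa_trans M -> normal_pop_first t \/ normal_pop_higher t.

(* OMPAs are assumed to be in normal form throughout. *)
Definition is_ompa : Prop := ordered /\ normal_form.

End MPA.

(** * Generalized pushdown automata *)

(* The values of [gpa_delta] are arbitrary, possibly infinite, languages. *)
Record gpa (P Sigma G : finType) := GPA {
  gpa_delta : P -> G -> option Sigma -> P -> language G;
  gpa_init : P;
  gpa_gamma0 : G;
  gpa_final : {set P}
}.

Section GPA.
Variables (P Sigma G : finType) (A : gpa P Sigma G).

Definition gpa_config : Type := (P * seq G)%type.

Definition gpa_step (c : gpa_config) (a : option Sigma) (c' : gpa_config) :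
    Prop :=
  exists (p p' : P) (g : G) (u w : seq G),
    [/\ gpa_delta A p g a p' u, c = (p, g :: w) & c' = (p', u ++ w)].

Definition gpa_lang : language Sigma := fun tau =>
  exists2 p, p \in gpa_final A &
    run gpa_step (gpa_init A, [:: gpa_gamma0 A]) tau (p, [::]).

End GPA.

(* $Q \cup \{p_0, p_f\}$ with $p_0, p_f \notin Q$ is the disjoint sum
   [Q + bool]. *)
Definition p0 (Q : finType) : (Q + bool)%type := inr false.
Definition pf (Q : finType) : (Q + bool)%type := inr true.

(* Main.v *)
Require Import Defs.
From mathcomp Require Import all_boot.
From mathcomp Require Import zify.

(* Cut an accepting run of M at the transitions popping stack n. At such a
   transition stacks 1..n-1 are empty, and between two of them stack n only
   grows, so it can be replaced by an output tape: a segment is a run of an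
   OMPA on the first n-1 stacks, whose output, reversed, is the word pushed on
   stack n. The GPA keeps stack n as its own stack and performs one whole
   segment per step. Guessing the last segment leads to pf, which is stuck, so
   the guess succeeds only if stack n is empty by then. *)

Set Implicit Arguments.
Unset Strict Implicit.
Unset Printing Implicit Defensive.

(** * Runs and legal stack contents *)

Lemma run_trans (C A : Type) (step : C -> option A -> C -> Prop) c1 c2 c3 u v :
  run step c1 u c2 -> run step c2 v c3 -> run step c1 (u ++ v) c3.
Proof.
elim=> [c //|c a c' w c'' st _ IH] /IH r.
by rewrite -catA; apply: run_cons st r.
Qed.

Definition start_stacks (n : nat) (G : Type) (bot g : G) : {ffun 'I_n -> seq G} :=
  [ffun i : 'I_n => if i == 0 :> nat then [:: g; bot] else [:: bot]].

Definition empty_stacks (n : nat) (G : Type) (bot : G) : {ffun 'I_n -> seq G} :=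
  [ffun=> [:: bot]].

(** The stack witnessing the order is the first one for one shape of transition and stack [i] for
    the other. For the automata built below, only normal form is then left to check. *)
Lemma normal_form_ordered (n : nat) (Q Sigma G : finType)
  (M : mpa n Q Sigma G) : normal_form M -> ordered M.
Proof.
move=> nf t /nf [[g Hg]|[i [g [g' [_ _ _ Hi]]]]].
  exists (Ordinal (mpa_stacks_gt0 M)); split=> j //= j_gt0.
  by have [-> _] := Hg j; rewrite gtn_eqF.
exists i; split=> j ltij; have [-> _] := Hi j; first by rewrite ltij.
by rewrite ltnNge ltnW //= -val_eqE gtn_eqF.
Qed.

Lemma is_stack_cons (n : nat) (Q Sigma G : finType) (M : mpa n Q Sigma G) g w :
  g <> mpa_bot M -> is_stack M (g :: w) <-> is_stack M w.
Proof.
move=> gb; split=> [[[|x u] /= ux]|[u ux ->]].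
- by case=> /gb.
- by case=> _ ->; exists u => //; move: ux; rewrite inE negb_or => /andP[].
- by exists (g :: u) => //; rewrite inE negb_or ux eq_sym andbT; apply/eqP.
Qed.

Lemma is_stack_bot (n : nat) (Q Sigma G : finType) (M : mpa n Q Sigma G) w :
  is_stack M (mpa_bot M :: w) <-> w = [::].
Proof.
split=> [[[|x u] /= ux]|->]; last by exists [::].
  by case.
by case=> /esym eqx; rewrite inE eqx eqxx in ux.
Qed.

(** * Starting an OMPA from any of a set of configurations *)

Section MultiStart.

Variables (n : nat) (Q Sigma G : finType) (N : mpa n Q Sigma G).
Variables (I : {set Q * G}) (T : {set Q}).

Definition some_trans (t : transition n Q Sigma G) :
    transition n (option Q) Sigma G :=
  ((Some (src t), t.1.1.2), label t, (Some (dst t), t.2.2)).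

(** The fresh initial state [None] trades the initial symbol for [x.2]. Only the first stack is
    read, so normal form is kept. *)
Definition start_trans (x : Q * G) : transition n (option Q) Sigma G :=
  ((None, [ffun i : 'I_n => if i == 0 :> nat then Some (mpa_gamma0 N) else None]),
   None,
   (Some x.1, [ffun i : 'I_n => if i == 0 :> nat then [bseq x.2] else [bseq]])).

(** Pairs with symbol [bot] are discarded because a transition popping another symbol may not push
    [bot]. *)
Definition multi_trans : {set transition n (option Q) Sigma G} :=
  [set some_trans t | t in mpa_trans N] :|:
  [set start_trans x | x in I & x.2 != mpa_bot N].

Lemma multi_transP t : t \in multi_trans ->
  (exists2 t', t' \in mpa_trans N & t = some_trans t') \/
  (exists x, [/\ x \in I, x.2 <> mpa_bot N & t = start_trans x]).
Proof.
case/setUP=> /imsetP[x xI ->]; [left | right]; first by exists x.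
by exists x; move: xI; rewrite inE => /andP[-> /eqP].
Qed.

Lemma multi_trans_wf t : t \in multi_trans -> transition_wf (mpa_bot N) t.
Proof.
case/multi_transP=> [[t' tN ->]|[x [_ xb ->]]]; first exact: mpa_trans_wf tN.
move=> i; rewrite /pop /push /= !ffunE; case: ifP => _; split=> //.
  by move=> _; rewrite inE eq_sym; apply/eqP.
by case=> /mpa_gamma0_neq_bot.
Qed.

Definition multi_start : mpa n (option Q) Sigma G :=
  MPA None (Some @: T) (mpa_stacks_gt0 N) (@mpa_gamma0_neq_bot _ _ _ _ N)
    multi_trans_wf.

Lemma multi_start_ompa : is_ompa N -> is_ompa multi_start.
Proof.
move=> [_ nf]; have nf' : normal_form multi_start; last first.
  by split=> //; apply: normal_form_ordered.
move=> t /multi_transP[[t' /nf tN ->]|[x [_ xb ->]]]; first exact: tN.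
left; exists (mpa_gamma0 N) => j; rewrite /pop /push !ffunE; split=> // j_gt0.
by exists None; rewrite //= gtn_eqF.
Qed.

(** There is at most one start transition for each pair of a state and a stack symbol; this product
    is the source of the quadratic bound. *)
Lemma multi_start_size :
  mpa_size multi_start <= mpa_size N + #|Q| * #|G| + 1.
Proof.
have arith a b c d t t' e : t' <= t + e ->
  a + b.+1 + c + d + t' <= a + b + c + d + t + e + 1 by lia.
rewrite /mpa_size card_option; apply: arith.
apply: leq_trans (leq_card_setU _ _) _; apply: leq_add.
  exact: leq_imset_card.
by apply: leq_trans (leq_imset_card _ _) _; rewrite -card_prod max_card.
Qed.

Lemma multi_step_some q s a d :
  mpa_step multi_start (Some q, s) a d <->
  exists2 c, mpa_step N (q, s) a c & d = (Some c.1, c.2).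
Proof.
split=> [[t [w [/multi_transP[[t' tN ->]|[x [_ _ ->]]] st]]]|].
- case=> -> -> -> ->; exists (dst t', [ffun i => push t' i ++ w i]) => //.
  by exists t', w.
- by case.
- case=> c [t [w [tN st [-> ->] -> ->]]] ->.
  exists (some_trans t), w; split=> //.
  by apply/setUP; left; apply: imset_f.
Qed.

Lemma multi_run_some q s w d :
  run (mpa_step multi_start) (Some q, s) w d <->
  exists2 c, run (mpa_step N) (q, s) w c & d = (Some c.1, c.2).
Proof.
split=> [r|[c r ->]].
  move: {1 2}(Some q, s) r (erefl (Some q, s)) => c r.
  elim: r q s => {c w d} [c q s ->|c a c' w d st _ IH q s eqc].
    by exists (q, s) => //; apply: run_nil.
  move: st; rewrite eqc => /multi_step_some[[q' s'] st eqc'].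
  have [e r ->] := IH _ _ eqc'; exists e => //; exact: run_cons st r.
rewrite -[q]/(q, s).1 -[s in (_, s)]/(q, s).2.
elim: r => {q s w c} [c|c a c' w e st _ IH]; first exact: run_nil.
apply: run_cons IH; apply/multi_step_some; exists c' => //.
by case: c st.
Qed.

Lemma multi_start_lang w :
  mpa_lang multi_start w <->
  exists x q, [/\ x \in I, x.2 <> mpa_bot N, q \in T &
    run (mpa_step N) (x.1, start_stacks n (mpa_bot N) x.2) w
      (q, empty_stacks n (mpa_bot N))].
Proof.
split=> [[_ /imsetP[q qT ->] r]|[x [q [xI xb qT r]]]].
  (* [None] is not accepting, so there is a first step, and only start transitions leave [None]. *)
  inversion r as [|c a c' u c'' st r' e1 e2 e3]; subst.
  case: st => t [v [/multi_transP[[t' tN ->]|[x [xI xb ->]]] st]]; first by case.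
  move=> [eqv] -> eqc'; exists x, q; split=> //.
  move: r'; rewrite {}eqc' => /multi_run_some[[q' s'] /= r' [eqq eqs]].
  move: r'; rewrite -eqq -eqs /=.
  suff -> : [ffun i => push (start_trans x) i ++ v i] =
            start_stacks n (mpa_bot N) x.2 by exact.
  apply/ffunP=> i; have := congr1 (fun f : {ffun _} => f i) eqv.
  by rewrite !ffunE /pop /push /= !ffunE; case: eqP => _ /= [] // <-.
exists (Some q); first exact: imset_f.
rewrite -[w]/(oword None ++ w).
apply: (@run_cons _ _ _ _ _ (Some x.1, start_stacks n (mpa_bot N) x.2)).
  exists (start_trans x), (empty_stacks n (mpa_bot N)); split=> //.
  - apply/setUP; right; apply: imset_f; rewrite inE xI; exact/eqP.
  - move=> i; rewrite /pop /= !ffunE; case: eqP => _ /=.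
      by apply/is_stack_cons; [apply: mpa_gamma0_neq_bot | apply/is_stack_bot].
    exact/is_stack_bot.
  - by congr pair; apply/ffunP=> i; rewrite !ffunE /pop /= !ffunE; case: eqP.
  - by congr pair; apply/ffunP=> i; rewrite !ffunE /push /= !ffunE; case: eqP.
by apply/multi_run_some; exists (q, empty_stacks n (mpa_bot N)).
Qed.

End MultiStart.

(** * Replacing the last stack by an output tape *)

Section DropLast.

Variables (m : nat) (Q Sigma G : finType) (M : mpa m.+2 Q Sigma G).

Notation bot := (mpa_bot M).
Notation last_stack := (@ord_max m.+1).
Notation below := (lift (@ord_max m.+1)).

Lemma belowP (i : 'I_m.+2) : i < last_stack -> exists j, i = below j.
Proof.
case: (unliftP last_stack i) => [j -> _|->]; first by exists j.
by rewrite ltnn.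
Qed.

(** The letter read by [M] is forgotten, since only emptiness of its language matters, and the
    letter pushed on the last stack becomes the label. In normal form [ohead] loses nothing on the
    transitions kept: by [push_last] they push at most one letter there. *)
Definition drop_trans (t : transition m.+2 Q Sigma G) : transition m.+1 Q G G :=
  ((src t, [ffun i => pop t (below i)]), ohead (push t last_stack),
   (dst t, [ffun i => t.2.2 (below i)])).

Lemma pop_drop t i : pop (drop_trans t) i = pop t (below i).
Proof. by rewrite {1}/pop ffunE. Qed.

Lemma push_drop t i : push (drop_trans t) i = push t (below i).
Proof. by rewrite {1}/push ffunE. Qed.

Definition drop_transs : {set transition m.+1 Q G G} :=
  [set drop_trans t | t in mpa_trans M & pop t last_stack == None].

Lemma drop_transsP t : t \in drop_transs ->
  exists t', [/\ t' \in mpa_trans M, pop t' last_stack = None & t = drop_trans t'].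
Proof.
by case/imsetP=> t'; rewrite inE => /andP[tM /eqP pt] ->; exists t'.
Qed.

Lemma drop_trans_wf t : t \in drop_transs -> transition_wf bot t.
Proof.
case/drop_transsP=> t' [tM _ ->] i; rewrite pop_drop push_drop.
exact: mpa_trans_wf tM (below i).
Qed.

Definition drop_last : mpa m.+1 Q G G :=
  MPA (mpa_init M) (mpa_final M) (ltn0Sn m) (@mpa_gamma0_neq_bot _ _ _ _ M)
    drop_trans_wf.

Lemma drop_last_ompa : is_ompa M -> is_ompa drop_last.
Proof.
move=> [_ nf]; have nf' : normal_form drop_last; last first.
  by split=> //; apply: normal_form_ordered.
move=> t /drop_transsP[t' [/nf tM pt ->]].
case: tM => [[g Hg]|[i [g [g' [i0 gb gb' Hi]]]]].
  left; exists g => j; rewrite pop_drop push_drop.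
  by have := Hg (below j); rewrite lift_max.
(* Stack [i] is popped while nothing is popped from the last stack, so they differ. *)
right; have /belowP[j ij] : i < last_stack.
  rewrite ltn_neqAle -ltnS ltn_ord andbT; apply/eqP => /val_inj eqi.
  by have [] := Hi i; rewrite ltnn eqxx eqi pt.
exists j, g, g'; split=> //; first by rewrite -(lift_max j) -ij.
move=> k; have := Hi (below k).
by rewrite pop_drop push_drop ij (inj_eq lift_inj) !lift_max.
Qed.

Lemma drop_last_size : mpa_size drop_last <= mpa_size M + #|G|.
Proof.
have arith a b c d t t' : t' <= t ->
  a + b + d + d + t' <= a.+1 + b + c + d + t + d by lia.
apply: arith; apply: leq_trans (leq_imset_card _ _) _.
apply: subset_leq_card.
by apply/subsetP=> t; rewrite inE => /andP[].
Qed.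

Lemma push_last t : normal_form M -> t \in mpa_trans M ->
  pop t last_stack = None ->
  exists2 h : option G, h <> Some bot & push t last_stack = oword h.
Proof.
move=> nf /nf [[g Hg] _|[i [g [g' [i0 gb gb' Hi]]]]].
  by have [_ ] := Hg last_stack; apply.
have [-> ->] := Hi last_stack; case: (ltnP last_stack i) => // _.
by case: eqP => // _ _; exists None.
Qed.

Lemma pop_last t g : normal_form M -> t \in mpa_trans M ->
  pop t last_stack = Some g ->
  exists g', [/\ g <> bot, g' <> bot &
    forall j, pop t j = Some (if j < last_stack then bot else g) /\
      push t j = (if j == 0 :> nat then [:: g'; bot]
                  else if j < last_stack then [:: bot] else [::])].
Proof.
move=> nf /nf [[g1 Hg]|[i [g1 [g' [i0 gb gb' Hi]]]]].
  by have [->] := Hg last_stack.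
have [-> _] := Hi last_stack; rewrite ltnNge -ltnS ltn_ord /=.
case: eqP => // ei [<-]; exists g'; split=> // j.
have [-> ->] := Hi j; rewrite -ei; split=> //; case: ltnP => // lej.
case: eqP => // /eqP; rewrite -val_eqE /= => /negP[].
by rewrite eqn_leq lej -ltnS ltn_ord.
Qed.

(** * Contents of the last stack, segments and the GPA *)

Definition ext (s : {ffun 'I_m.+1 -> seq G}) (w : seq G) :
    {ffun 'I_m.+2 -> seq G} :=
  [ffun i => if unlift last_stack i is Some j then s j else w].

Lemma ext_below s w i : ext s w (below i) = s i.
Proof. by rewrite ffunE liftK. Qed.

Lemma ext_last s w : ext s w last_stack = w.
Proof. by rewrite ffunE unlift_none. Qed.

Lemma extP (f : {ffun 'I_m.+2 -> seq G}) (s : {ffun 'I_m.+1 -> seq G}) w :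
  (forall i, f (below i) = s i) -> f last_stack = w -> f = ext s w.
Proof.
move=> fs fw; apply/ffunP=> i; rewrite ffunE.
by case: unliftP => [j ->|->].
Qed.

Lemma ext_inj s1 s2 w1 w2 : ext s1 w1 = ext s2 w2 -> s1 = s2 /\ w1 = w2.
Proof.
move=> e; split; last by rewrite -[w1](ext_last s1) e ext_last.
by apply/ffunP=> i; rewrite -(ext_below s1 w1) e ext_below.
Qed.

Lemma start_stacks_ext g :
  start_stacks m.+2 bot g = ext (start_stacks m.+1 bot g) [:: bot].
Proof. by apply: extP => [i|]; rewrite !ffunE ?lift_max. Qed.

Lemma empty_stacks_ext :
  empty_stacks m.+2 bot = ext (empty_stacks m.+1 bot) [:: bot].
Proof. by apply: extP => [i|]; rewrite !ffunE. Qed.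

(** A segment begins right after [g] is popped from the last stack in state [q]. Normal form then
    leaves one symbol on the first stack, so a state and a symbol determine the lower stacks. The
    initial configuration has the same form, and [p0] reaches it by consuming the initial [bot] of
    the GPA. *)
Definition starts (p : (Q + bool)%type) (g : G) : {set Q * G} :=
  match p with
  | inl q => [set x | [exists t in mpa_trans M,
      [&& src t == q, pop t last_stack == Some g, dst t == x.1 &
          push t ord0 == [:: x.2; bot]]]]
  | inr false => if g == bot then [set (mpa_init M, mpa_gamma0 M)] else set0
  | inr true => set0
  end.

(** A segment ends where the next pop of the last stack occurs, in the guessed state [q], or at
    acceptance for [pf]; none returns to [p0]. *)
Definition ends (p : (Q + bool)%type) : {set Q} :=
  match p with
  | inl q => [set q]
  | inr false => set0
  | inr true => mpa_final M
  end.

Definition segment (p1 : (Q + bool)%type) (g : G) (p2 : (Q + bool)%type) :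
    mpa m.+1 (option Q) G G :=
  multi_start drop_last (starts p1 g) (ends p2).

(** A stack word lists its top first, whereas a segment emits the deepest letter first; hence
    [rev]. *)
Definition segment_gpa : gpa (Q + bool)%type void G :=
  GPA (fun p1 g _ p2 u => mpa_lang (segment p1 g p2) (rev u))
    (p0 Q) bot [set pf Q].

Lemma segment_size p1 g p2 :
  mpa_size (segment p1 g p2) <= 3 * mpa_size M ^ 2.
Proof.
have := multi_start_size drop_last (starts p1 g) (ends p2).
have := drop_last_size.
have : #|Q| + #|G| <= mpa_size M by rewrite /mpa_size; lia.
have : 1 < mpa_size M by rewrite /mpa_size; lia.
(* With [a] the size of [M], the total is at most [a + #|G| + #|Q| * #|G| + 1]. The product is at
   most [a ^ 2], and the rest is at most [2 * a + 1], hence at most [2 * a ^ 2] as [a] is at least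
   2. *)
rewrite /segment; move: (mpa_size M) (mpa_size drop_last) (mpa_size _) => a b c.
nia.
Qed.

(** * Correspondence of single steps *)

Lemma startsP q g x : normal_form M -> x \in starts (inl q) g ->
  forall v, is_stack M (g :: v) ->
  exists a, mpa_step M (q, ext (empty_stacks m.+1 bot) (g :: v)) a
    (x.1, ext (start_stacks m.+1 bot x.2) v).
Proof.
move=> nf; rewrite inE => /existsP[t /and5P[tM /eqP <- /eqP pt /eqP <- /eqP pt0]].
have [g' [gb gb' Hj]] := pop_last nf tM pt.
have [_] := Hj ord0; rewrite pt0 /= => -[e] v gv; rewrite -{}e in Hj.
exists (label t), t, (ext [ffun=> [::]] v); split=> //.
- move=> i; have [-> _] := Hj i; case: (unliftP last_stack i) => [j ->|->].
    rewrite lift_max ltn_ord ext_below ffunE; exact/is_stack_bot.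
  by rewrite ltnn ext_last.
- congr pair; apply/esym/extP => [i|]; rewrite ffunE.
    have [-> _] := Hj (below i); rewrite lift_max ltn_ord ext_below.
    by rewrite !ffunE.
  by have [-> _] := Hj last_stack; rewrite ltnn ext_last.
- congr pair; apply/esym/extP => [i|]; rewrite ffunE.
    have [_ ->] := Hj (below i); rewrite lift_max ltn_ord ext_below.
    by rewrite !ffunE cats0.
  by have [_ ->] := Hj last_stack; rewrite ltnn ext_last.
Qed.

(** If the last stack is not popped, the step is internal to a segment and emits [b]. If it is
    popped, normal form forces all lower stacks to be empty, and the step is a boundary between
    segments. *)
Lemma mpa_step_drop q f a q' f' : normal_form M ->
  mpa_step M (q, f) a (q', f') ->
  (exists s s' w b,
    [/\ f = ext s w, f' = ext s' (oword b ++ w),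
        b <> Some bot & mpa_step drop_last (q, s) b (q', s')]) \/
  (exists g g' w,
    [/\ f = ext (empty_stacks m.+1 bot) (g :: w),
        f' = ext (start_stacks m.+1 bot g') w,
        g <> bot, g' <> bot & (q', g') \in starts (inl q) g]).
Proof.
move=> nf [t [w [tM st [-> ->] _ [-> ->]]]].
case pt: (pop t last_stack) => [g|]; [right | left].
  have [g' [gb gb' Hj]] := pop_last nf tM pt.
  (* A lower stack reads [bot], and nothing lies under [bot] in a legal stack. *)
  have wb i : w (below i) = [::].
    have := st (below i); have [-> _] := Hj (below i).
    by rewrite lift_max ltn_ord => /is_stack_bot.
  exists g, g', (w last_stack); split=> //.
  - apply/extP => [i|]; rewrite ffunE; last by rewrite pt.
    by have [-> _] := Hj (below i); rewrite lift_max ltn_ord wb ffunE.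
  - apply/extP => [i|]; rewrite ffunE.
      have [_ ->] := Hj (below i).
      by rewrite lift_max ltn_ord wb cats0 ffunE.
    by have [_ ->] := Hj last_stack; rewrite ltnn.
  - rewrite inE; apply/existsP; exists t; rewrite tM pt !eqxx /=.
    by have [_ ->] := Hj ord0.
have [h hb ph] := push_last nf tM pt.
exists [ffun i => oword (pop t (below i)) ++ w (below i)],
  [ffun i => push t (below i) ++ w (below i)], (w last_stack), h; split=> //.
- by apply/extP => [i|]; rewrite !ffunE ?pt.
- by apply/extP => [i|]; rewrite !ffunE ?ph.
- exists (drop_trans t), [ffun i => w (below i)]; split=> //.
  + by apply: imset_f; rewrite inE tM pt eqxx.
  + by move=> i; rewrite pop_drop ffunE; apply: st.
  + by congr pair; apply/ffunP=> i; rewrite !ffunE pop_drop.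
  + by rewrite /label /= ph; case: (h).
  + by congr pair; apply/ffunP=> i; rewrite !ffunE push_drop.
Qed.

Lemma drop_step_lift q s b q' s' v : normal_form M ->
  mpa_step drop_last (q, s) b (q', s') -> is_stack M v ->
  is_stack M (oword b ++ v) /\
  exists a, mpa_step M (q, ext s v) a (q', ext s' (oword b ++ v)).
Proof.
move=> nf [_ [w [/drop_transsP[t [tM pt ->]] st [-> ->] -> [-> ->]]]] vst.
have [h hb ph] := push_last nf tM pt.
have lh : label (drop_trans t) = h by rewrite /label /= ph; case: (h).
rewrite lh; split.
  case: h hb {ph lh} => [x|] //= xb; apply/is_stack_cons => // xe.
  by case: xb; rewrite xe.
exists (label t), t, (ext w v); split=> //.
- move=> i; case: (unliftP last_stack i) => [j ->|->].
    by rewrite ext_below -pop_drop; apply: st.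
  by rewrite pt ext_last.
- congr pair; apply/esym/extP => [i|]; rewrite ffunE.
    by rewrite ext_below ffunE pop_drop.
  by rewrite pt ext_last.
- congr pair; apply/esym/extP => [i|]; rewrite ffunE.
    by rewrite ext_below ffunE push_drop.
  by rewrite ph ext_last.
Qed.

(** * Correspondence of runs *)

Lemma drop_run_lift c u c' v : normal_form M ->
  run (mpa_step drop_last) c u c' -> is_stack M v ->
  is_stack M (rev u ++ v) /\
  exists tau, run (mpa_step M) (c.1, ext c.2 v) tau (c'.1, ext c'.2 (rev u ++ v)).
Proof.
move=> nf r; elim: r v => {c u c'} [c|[q s] a [q' s'] w c'' st _ IH] v vst.
  by split=> //; exists [::]; apply: run_nil.
have [vst' [b st']] := drop_step_lift nf st vst.
have [vst'' [tau r]] := IH _ vst'.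
have -> : rev (oword a ++ w) ++ v = rev w ++ oword a ++ v.
  by rewrite rev_cat -catA; case: (a).
split=> //; exists (oword b ++ tau); exact: run_cons st' r.
Qed.

(** A GPA configuration [(p, v)] stands for every configuration of [M] with state in [ends p], empty
    lower stacks and [v ++ [:: bot]] on the last stack. Each GPA step unfolds into one pop of the
    last stack followed by a lifted segment. *)
Lemma gpa_run_sound p v w : normal_form M ->
  run (gpa_step segment_gpa) (p, v) w (pf Q, [::]) ->
  forall q, q \in ends p -> is_stack M (v ++ [:: bot]) ->
  exists2 q', q' \in mpa_final M & exists tau,
    run (mpa_step M) (q, ext (empty_stacks m.+1 bot) (v ++ [:: bot])) tau
      (mpa_empty_config M q').
Proof.
move=> nf r; move: {1 2}(p, v) {1 2}(pf Q, [::]) r (erefl (p, v)) (erefl (pf Q, Nil G)).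
move=> c c' r; elim: r p v => {c c' w} [c p v -> [-> ->] q qF _|].
  exists q => //; exists [::]; rewrite /= -empty_stacks_ext; exact: run_nil.
move=> c a c' w c'' [p [p' [g [u [w' [uL -> ->]]]]]] _ IH _ _ [<- <-] e q qp /= gst.
(* No GPA step leaves [pf], and [ends] is empty at [p0], so [p] is a state of [M]. *)
case: p qp uL => [q0 /set1P->|b] /=; last first.
  case: b => [_|]; last by rewrite inE.
  by case/multi_start_lang=> x [q1 []]; rewrite inE.
case/multi_start_lang=> x [q1 [xI xb q1e r]].
have wst : is_stack M (w' ++ [:: bot]).
  case: gst => -[|y s] /= sb; first by case: (w').
  case=> _ ->; exists s => //; move: sb; rewrite inE negb_or => /andP[] //.
have [a1 st] := startsP nf xI gst.
have [] := drop_run_lift nf r wst; rewrite revK catA => ust [tau1 r1].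
have [q' q'F [tau2 r2]] := IH _ _ (erefl _) e _ q1e ust.
exists q' => //; exists (oword a1 ++ tau1 ++ tau2).
by apply: run_cons st _; apply: run_trans r1 r2.
Qed.

(** Induction from the end of the run requires a statement about configurations in the middle of a
    segment: [u] is what the current segment still emits, [p2] is where it leads, and the GPA
    finishes from there. *)
Lemma gpa_run_complete c tau q : normal_form M ->
  q \in mpa_final M -> run (mpa_step M) c tau (mpa_empty_config M q) ->
  exists s v p2 q2 u,
    [/\ c.2 = ext s (v ++ [:: bot]), q2 \in ends p2,
        run (mpa_step drop_last) (c.1, s) u (q2, empty_stacks m.+1 bot) &
        run (gpa_step segment_gpa) (p2, rev u ++ v) [::] (pf Q, [::])].
Proof.
move=> nf qF r.
move: {1 2}(mpa_empty_config M q) r (erefl (mpa_empty_config M q)) => d r.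
elim: r => {c tau d} [c ->|].
  exists (empty_stacks m.+1 bot), [::], (pf Q), q, [::]; split=> //.
  - exact: empty_stacks_ext.
  - exact: run_nil.
  - exact: run_nil.
move=> [q1 f] a [q1' f'] w d st _ IH /IH {IH} [s' [v' [p2 [q2 [u [/= ef' q2e r rg]]]]]].
have [[s1 [s1' [w1 [b [ef ef1 bb st']]]]]|] := mpa_step_drop nf st.
  have [es ew] := ext_inj (etrans (esym ef') ef1); rewrite es in r.
  (* The emitted letter is not [bot], so it lies above the bottom of the last stack and is the head
     of [v']. *)
  have [v ew1 ev'] : exists2 v, w1 = v ++ [:: bot] & v' = oword b ++ v.
    case: b ew bb {st' ef1} => [x|] /= ew; last by exists v'.
    case: v' ew {ef' rg} => [[-> _] []//|y v' [-> <-] _]; by exists v'.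
  exists s1, v, p2, q2, (oword b ++ u); split=> //.
  - by rewrite ef ew1.
  - exact: run_cons st' r.
  - have -> // : rev (oword b ++ u) ++ v = rev u ++ v'.
    by rewrite ev' rev_cat -catA; case: (b).
move=> [g [g' [w1 [ef ef1 gb gb' st']]]].
have [es ew] := ext_inj (etrans (esym ef') ef1); rewrite es in r.
(* Just before the pop the earlier segment is over, with nothing left to emit; the segment begun by
   the pop becomes one GPA step. *)
exists (empty_stacks m.+1 bot), (g :: v'), (inl q1), q1, [::]; split.
- by rewrite /= ef -ew.
- by rewrite inE.
- exact: run_nil.
rewrite -[Nil void]/(oword None ++ [::]); apply: run_cons rg.
exists (inl q1), p2, g, (rev u), v'; split=> //=.
by apply/multi_start_lang; exists (q1', g'), q2; split; rewrite ?revK.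
Qed.

Lemma segment_gpa_nonempty : normal_form M ->
  lang_nonempty (mpa_lang M) <-> lang_nonempty (gpa_lang segment_gpa).
Proof.
move=> nf; split=> [[tau [q qF r]]|[w [_ /set1P-> r]]].
  have [s [v [p2 [q2 [u [/= es q2e r' rg]]]]]] := gpa_run_complete nf qF r.
  have [es' ev] := ext_inj (etrans (esym es) (start_stacks_ext _)).
  (* Initially the last stack holds only [bot], so the first GPA step leaves exactly [rev u] on the
     stack. *)
  have v0 : v = [::] by case: v ev {es rg} => // x [].
  exists [::], (pf Q); first by rewrite inE.
  rewrite -[Nil void]/(oword None ++ [::]); apply: run_cons rg.
  exists (p0 Q), p2, bot, (rev u), [::]; split=> //; last by rewrite v0.
  apply/multi_start_lang; exists (mpa_init M, mpa_gamma0 M), q2.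
  rewrite revK /= eqxx inE eqxx -es'; split=> //; exact: mpa_gamma0_neq_bot.
(* The initial state differs from [pf], so there is a first GPA step; it is the segment from the
   initial configuration of [M]. *)
inversion r as [|c a c' u c'' st r' e1 e2 e3]; subst.
case: st => p [p' [g [v [w' [vL [ep eg ew] ec']]]]].
rewrite -{}ep -{}eg in vL; rewrite {}ec' -{}ew cats0 in r'.
case/multi_start_lang: vL => x [q1 []]; rewrite /= eqxx => /set1P-> _ q1e rN.
have bst : is_stack M [:: bot] by apply/is_stack_bot.
have [] := drop_run_lift nf rN bst; rewrite revK /= => vst [tau1 r1].
have [q' q'F [tau2 r2]] := gpa_run_sound nf r' q1e vst.
exists (tau1 ++ tau2), q' => //; apply: run_trans r2.
by move: r1; rewrite -start_stacks_ext.
Qed.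

End DropLast.

(* "It is possible to construct" is rendered by informative (Type-valued)
   existentials, so that a proof is a function producing the automata from M;
   a Prop-valued existential would be settled by a mere classical case
   distinction on the emptiness of L(M). The constant C of the O(|M|^2) bound
   is chosen before M. *)
Theorem theorem4p1 :
  {C : nat &
    forall (n : nat) (Q Sigma G : finType) (M : mpa n Q Sigma G),
      is_ompa M -> 1 < n ->
      {P : gpa (Q + bool)%type void G &
        (([/\ gpa_init P = p0 Q,
              gpa_gamma0 P = mpa_bot M,
              gpa_final P = [set pf Q]
            & lang_nonempty (mpa_lang M) <-> lang_nonempty (gpa_lang P)]) *
         (forall (p1 : (Q + bool)%type) (g : G) (p2 : (Q + bool)%type),
            {Q' : finType & {G' : finType & {M' : mpa n.-1 Q' G G' |
              [/\ is_ompa M',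
                  lang_eq (mpa_lang M') (lang_rev (gpa_delta P p1 g None p2))
                & mpa_size M' <= C * mpa_size M ^ 2]}}}))%type}}.
Proof.
exists 3 => -[|[|m]] // Q Sigma G M ompaM _; exists (segment_gpa M); split.
  by split=> //; apply: segment_gpa_nonempty; case: ompaM.
move=> p1 g p2; exists (option Q), G, (segment M p1 g p2); split.
- exact/multi_start_ompa/drop_last_ompa.
- move=> w; split=> [wL|[u uL ->] //].
  by exists (rev w); rewrite /= revK.
- exact: segment_size.
Qed.
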